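(* Let $\Phi:\mathbb{T}^n\times N\to N$ and $\Phi':\mathbb{T}^d\times N'\to N'$ be regular torifications of the connected dually flat spaces $(M,h,\nabla)$ and $(M',h',\nabla')$ of dimensions $n$ and $d$, respectively. Let $(L,X,F)$ and $(L',X',F')$ be toric parametrizations of $N$ and $N'$, respectively, with induced toric factorizations $\pi=\kappa\circ\tau:TM\to M$ and $\pi'=\kappa'\circ\tau':TM'\to M'$. If $f:M\to M'$ is an isometric affine immersion, then its derivative $f_*:TM\to TM'$ satisfies $$f_*\circ(T_X)_t=(T_{X'})_{(\rho_{\tau'\tau}(f))_{*_e}t}\circ f_*$$ for all $t\in\mathbb{R}^n$, where $T_X:\mathbb{R}^n\times TM\to TM$, $(T_X)_t(u)=T_X(t,u)=u+\sum_{k=1}^nt_kX_k$, $T_{X'}:\mathbb{R}^d\times TM'\to TM'$ is defined similarly, and $(\rho_{\tau'\tau}(f))_{*_e}:\mathbb{R}^n\to\mathbb{R}^d$ is the derivative at the identity $e$ of the Lie group homomorphism $\rho_{\tau'\tau}(f):\mathbb{T}^n\to\mathbb{T}^d$.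
   Context: Dually flat spaces. A linear connection is flat if its torsion and curvature both vanish. If $(M,h)$ is a Riemannian manifold with a linear connection $\nabla$, the dual connection $\nabla^*$ is the unique linear connection with $Xh(Y,Z)=h(\nabla_XY,Z)+h(Y,\nabla^*_XZ)$ for all vector fields $X,Y,Z$. The triple $(M,h,\nabla)$ is a dually flat space if $\nabla$ and $\nabla^*$ are both flat. A coordinate system $(x_1,\dots,x_n)$ is $\nabla$-affine if $\nabla_{\partial/\partial x_i}\partial/\partial x_j=0$ for all $i,j$. A smooth map $f:M\to M'$ between dually flat spaces is affine if around every point of $M$ (and its image) there are $\nabla$-affine and $\nabla'$-affine coordinate systems in which $f$ is the restriction of an affine map $y\mapsto Ay+B$; it is isometric if $f^*h'=h$. Kähler structure on $TM$ (Dombrowski). Let $(M,h,\nabla)$ be dually flat, $\pi:TM\to M$ the projection, and $K:TTM\to TM$ the connector of $\nabla$ (the map, linear on each $T_u(TM)$, with $K(Y_*X)=\nabla_XY$ for all vector fields). For $u\in T_pM$ the map $A\mapsto(\pi_*A,KA)$ identifies $T_u(TM)$ with $T_pM\oplus T_pM$; under it set $g_u((v,w),(v',w'))=h_p(v,v')+h_p(w,w')$, $J_u(v,w)=(-w,v)$, $\omega_u((v,w),(v',w'))=h_p(v,w')-h_p(w,v')$. This makes $TM$ a Kähler manifold, and $TM$ always carries this structure. Parallel lattices. Let $(M,h,\nabla)$ be connected, $\dim M=n$. A parallel lattice is a subset $L\subset TM$ of the form $L=\{\sum_i k_iX_i(p)\mid p\in M,\ k_i\in\mathbb{Z}\}$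 where $X=(X_1,\dots,X_n)$ are $\nabla$-parallel vector fields forming a basis of $T_pM$ at every $p$; $X$ is called a generator of $L$. $\Gamma(L)$ is the group of maps $TM\to TM$, $u\mapsto u+\sum_ik_iX_i$ ($k\in\mathbb{Z}^n$); it does not depend on the generator, acts freely and properly by holomorphic isometries, and $M_L=TM/\Gamma(L)$ carries the quotient Kähler structure, with quotient map $q_L:TM\to M_L$; $\pi_L:M_L\to M$ is the map with $\pi_L\circ q_L=\pi$. Put $\mathbb{T}^n=\mathbb{R}^n/\mathbb{Z}^n$, with $\mathrm{Lie}(\mathbb{T}^n)=\mathbb{R}^n$ via the derivative at $0$ of the quotient map; for a generator $X$ let $\Phi_X([t],q_L(u))=q_L(u+\sum_it_iX_i)$, an action of $\mathbb{T}^n$ on $M_L$. Torifications. Let $N$ be a connected Kähler manifold of real dimension $2n$ with an effective holomorphic isometric action $\Phi:\mathbb{T}^n\times N\to N$; write $\Phi_a=\Phi(a,\cdot)$ and let $N^\circ$ be the set of points where $\Phi$ is free. $N$ (or $\Phi$) is a torification of the connected $n$-dimensional dually flat space $(M,h,\nabla)$ if there is a toric parametrization, i.e. a triple $(L,X,F)$ where $L$ is a parallel lattice generated by $X$ and $F:M_L\to N^\circ$ is a holomorphic isometric diffeomorphism with $F\circ(\Phi_X)_a=\Phi_a\circ F$ for all $a\in\mathbb{T}^n$. The toric factorization induced by $(L,X,F)$ is the pair $\tau=F\circ q_L:TM\to N^\circ$, $\kappa=\pi_L\circ F^{-1}:N^\circ\to M$, so that $\pi=\kappa\circ\tau$; $\tau$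 is called a compatible covering map. A Kähler manifold is regular if it is connected, simply connected, complete and its Kähler metric is real analytic; a torification is regular if $N$ is regular. Lifts. With $\tau,\tau'$ compatible covering maps of the regular torifications $N,N'$ and $f:M\to M'$ an isometric affine immersion, it is known that there is a unique smooth map $m_{\tau'\tau}(f):N\to N'$ with $m_{\tau'\tau}(f)\circ\tau=\tau'\circ f_*$, and a unique Lie group homomorphism $\rho_{\tau'\tau}(f):\mathbb{T}^n\to\mathbb{T}^d$ with $m_{\tau'\tau}(f)\circ\Phi_a=\Phi'_{\rho_{\tau'\tau}(f)(a)}\circ m_{\tau'\tau}(f)$ for all $a\in\mathbb{T}^n$. *)

(* Defs.v *)
From HB Require Import structures.
From mathcomp Require Import all_boot all_order all_algebra.
From mathcomp Require Import all_classical all_reals all_analysis.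

Set Implicit Arguments.
Unset Strict Implicit.
Unset Printing Implicit Defensive.

Import Order.TTheory GRing.Theory Num.Theory.
Import numFieldNormedType.Exports.

Local Open Scope classical_set_scope.
Local Open Scope ring_scope.

(** * Smooth and real analytic functions on open sets of R^n *)

Definition evec (R : realType) (n : nat) (i : 'I_n) : 'rV[R]_n := delta_mx 0 i.

Fixpoint Ck (R : realType) (n k : nat) (V : set 'rV[R]_n) (f : 'rV[R]_n -> R)
    {struct k} : Prop :=
  match k with
  | 0 => forall x, V x -> {for x, continuous f}
  | k'.+1 => (forall x, V x -> differentiable f x) /\
             forall i : 'I_n, Ck k' V (fun x => 'D_(evec R i) f x)
  end.

Definition smooth_near (R : realType) (n : nat) (x : 'rV[R]_n)
    (f : 'rV[R]_n -> R) : Prop :=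
  exists V : set 'rV[R]_n, [/\ open V, V x & forall k, Ck k V f].

Definition vsmooth_near (R : realType) (n m : nat) (x : 'rV[R]_n)
    (f : 'rV[R]_n -> 'rV[R]_m) : Prop :=
  forall j : 'I_m, smooth_near x (fun y => f y 0 j).

(** The degree [k] part of the power series [\sum_alpha a_alpha y ^ alpha]. *)
Definition homog_part (R : realType) (n : nat) (a : {ffun 'I_n -> nat} -> R)
    (y : 'rV[R]_n) (k : nat) : R :=
  \sum_(al : {ffun 'I_n -> 'I_k.+1} | (\sum_i al i == k)%N)
    a [ffun i => al i : nat] * \prod_i (y 0 i) ^+ al i.

Definition homog_part_abs (R : realType) (n : nat)
    (a : {ffun 'I_n -> nat} -> R) (y : 'rV[R]_n) (k : nat) : R :=
  \sum_(al : {ffun 'I_n -> 'I_k.+1} | (\sum_i al i == k)%N)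
    `|a [ffun i => al i : nat] * \prod_i (y 0 i) ^+ al i|.

Definition analytic_on (R : realType) (n : nat) (U : set 'rV[R]_n)
    (f : 'rV[R]_n -> R) : Prop :=
  forall x, U x -> exists a : {ffun 'I_n -> nat} -> R,
    \forall y \near (0 : 'rV[R]_n),
      cvg (series (homog_part_abs a y) @ \oo) /\
      series (homog_part a y) @ \oo --> f (x + y).

(** * Manifolds

    A manifold is a set with a family of injective parametrizations
    [c : pdom c -> M] by open sets of R^n (do Carmo's definition).  [charted]
    carries only the data, so that the manifold structures of tangent bundles,
    products and quotients are defined by giving their parametrizations;
    [is_manifold] states the axioms.  The values of [c] outside [pdom c] are
    irrelevant. *)

Record param (R : realType) (n : nat) (T : Type) := Param {
  pdom : set 'rV[R]_n ;
  pmap :> 'rV[R]_n -> T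
}.
Arguments Param {R n T}.

Record charted (R : realType) (n : nat) := Charted {
  carrier :> Type ;
  atlas : set (param R n carrier)
}.
Arguments Charted {R n}.
Arguments carrier {R n}.
Arguments atlas {R n}.

(** [A] is open iff [c^-1(A)] is open in [pdom c] for every parametrization. *)
Definition mopen (R : realType) (n : nat) (M : charted R n) (A : set M) : Prop :=
  forall c, atlas M c -> forall x, pdom c x -> A (c x) ->
    \forall y \near x, pdom c y -> A (c y).

Section ManifoldTopology.
Context (R : realType) (n : nat) (M : charted R n).

Lemma mopenT : mopen (setT : set M).
Proof. by move=> c _ x _ _; apply: (@nearW _ (nbhs x)). Qed.

Lemma mopenI (A B : set M) : mopen A -> mopen B -> mopen (A `&` B).
Proof.
move=> oA oB c cM x cx [Ax Bx].
have nA := oA c cM x cx Ax; have nB := oB c cM x cx Bx.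
move: nA nB; apply: (@filterS2 _ (nbhs x)) => y Ay By cy.
by split; [exact: Ay | exact: By].
Qed.

Lemma mopen_bigcup (I : Type) (f : I -> set M) :
  (forall i, mopen (f i)) -> mopen (\bigcup_i f i).
Proof.
move=> of_ c cM x cx [i _ fix_].
move: (of_ i c cM x cx fix_); apply: (@filterS _ (nbhs x)) => y fy cy.
by exists i => //; exact: fy.
Qed.

HB.instance Definition _ := gen_eqMixin (carrier M).
HB.instance Definition _ := gen_choiceMixin (carrier M).
HB.instance Definition _ :=
  isOpenTopological.Build (carrier M) mopenT mopenI mopen_bigcup.
End ManifoldTopology.

(** Smoothness of [f : M -> R] on a neighbourhood of [p]. *)
Definition smooth_fun_at (R : realType) (n : nat) (M : charted R n)
    (f : M -> R) (p : M) : Prop :=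
  forall c, atlas M c -> forall x, pdom c x -> c x = p ->
    smooth_near x (fun y => f (c y)).

(** [c'^-1 \o f \o c] is defined and smooth near [x]. *)
Definition smooth_expr (R : realType) (n m : nat) (T T' : Type)
    (c : param R n T) (c' : param R m T') (f : T -> T') (x : 'rV[R]_n) : Prop :=
  exists g : 'rV[R]_n -> 'rV[R]_m, vsmooth_near x g /\
    \forall y \near x, pdom c' (g y) /\ f (c y) = c' (g y).

Definition smooth_map_at (R : realType) (n m : nat) (M : charted R n)
    (M' : charted R m) (f : M -> M') (p : M) : Prop :=
  forall c, atlas M c -> forall x, pdom c x -> c x = p ->
  forall c', atlas M' c' -> forall x', pdom c' x' -> c' x' = f p ->
    smooth_expr c c' f x.

Definition smooth_map (R : realType) (n m : nat) (M : charted R n)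
    (M' : charted R m) (f : M -> M') : Prop :=
  forall p, smooth_map_at f p.

Definition compatible (R : realType) (n : nat) (T : Type)
    (c c' : param R n T) : Prop :=
  forall x x', pdom c x -> pdom c' x' -> c x = c' x' -> smooth_expr c c' id x.

Definition pinjective (R : realType) (n : nat) (T : Type) (c : param R n T) :=
  forall x y, pdom c x -> pdom c y -> c x = c y -> x = y.

Record is_manifold (R : realType) (n : nat) (M : charted R n) : Prop := {
  manifold_open : forall c, atlas M c -> open (pdom c) ;
  manifold_inj : forall c, atlas M c -> pinjective c ;
  manifold_cover : forall p : M, exists c x, [/\ atlas M c, pdom c x & c x = p] ;
  manifold_compat : forall c c', atlas M c -> atlas M c' -> compatible c c' ;
  manifold_hausdorff : hausdorff_space M ;
  manifold_countable : @second_countable M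
}.

(** The coordinate systems of [M], i.e. the maximal atlas. *)
Definition coord_system (R : realType) (n : nat) (M : charted R n)
    (c : param R n M) : Prop :=
  [/\ open (pdom c), pinjective c &
      forall c', atlas M c' -> compatible c c' /\ compatible c' c].

(** The coordinates of [p] (meaningful for [p] in the image of [c]). *)
Definition coords (R : realType) (n : nat) (T : Type) (c : param R n T) (p : T)
    : 'rV[R]_n :=
  xget 0 [set x | pdom c x /\ c x = p].

Definition euclid (R : realType) (n : nat) : charted R n :=
  Charted 'rV[R]_n [set Param setT id].

Definition prod_charted (R : realType) (n m : nat) (M : charted R n)
    (M' : charted R m) : charted R (n + m) :=
  Charted (M * M')%type
    [set e | exists c c', [/\ atlas M c, atlas M' c' &
       e = Param [set z | pdom c (lsubmx z) /\ pdom c' (rsubmx z)]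
                 (fun z => (c (lsubmx z), c' (rsubmx z)))]].

(** * Tangent vectors

    A tangent vector at [p] is a derivation of the germs at [p] of smooth
    functions, extended by 0 to the functions that are not smooth near [p].
    The Leibniz rule, applied to the indicator function of a neighbourhood of
    [p], forces the value to depend only on the germ. *)

Definition is_derivation (R : realType) (n : nat) (M : charted R n) (p : M)
    (D : (M -> R) -> R) : Prop :=
  [/\ forall f, ~ smooth_fun_at f p -> D f = 0,
      forall (a : R) f g, smooth_fun_at f p -> smooth_fun_at g p ->
        D (fun q => a * f q + g q) = a * D f + D g &
      forall f g, smooth_fun_at f p -> smooth_fun_at g p ->
        D (fun q => f q * g q) = D f * g p + f p * D g].

Definition derivations (R : realType) (n : nat) (M : charted R n) (p : M)
    : {pred (M -> R) -> R^o} :=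
  fun D => `[< is_derivation p D >].

Record tangent (R : realType) (n : nat) (M : charted R n) (p : M) := Tangent {
  dir :> (M -> R) -> R^o ;
  dirP : dir \in derivations p
}.

Section TangentSpace.
Context (R : realType) (n : nat) (M : charted R n) (p : M).

Lemma derivations_submod : submod_closed (derivations p).
Proof.
split=> [|a D E].
  apply/asboolP; split=> [//|b f g _ _|f g _ _].
    by rewrite /= mulr0 addr0.
  by rewrite /= mul0r mulr0 addr0.
move=> /asboolP[D0 DL DM] /asboolP[E0 EL EM]; apply/asboolP; split.
- by move=> f nf; rewrite /= !fctE D0// E0// scaler0 addr0.
- move=> b f g sf sg; rewrite /= !fctE DL// EL//.
  by rewrite /GRing.scale/= !mulrDr !mulrA (mulrC a b) addrACA.
- move=> f g sf sg; rewrite /= !fctE DM// EM//.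
  rewrite /GRing.scale/= !mulrDr !mulrDl !mulrA (mulrC a (f p)).
  by rewrite addrACA.
Qed.

HB.instance Definition _ :=
  GRing.isSubmodClosed.Build R ((M -> R) -> R^o) (derivations p)
    derivations_submod.
HB.instance Definition _ := [isSub for @dir R n M p].
HB.instance Definition _ := [Choice of tangent p by <:].
HB.instance Definition _ := [SubChoice_isSubLmodule of tangent p by <:].
End TangentSpace.

(** The tangent vector with underlying functional [D] (0 if [D] is not a
    derivation at [p]). *)
Definition mk_tangent (R : realType) (n : nat) (M : charted R n) (p : M)
    (D : (M -> R) -> R) : tangent p :=
  insubd (0 : tangent p)
    (fun f => if `[< smooth_fun_at f p >] then D f else 0).

(** The vector [\sum_i a_i d/dx_i] at [p], in the coordinates given by [c]. *)
Definition coord_vec (R : realType) (n : nat) (M : charted R n)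
    (c : param R n M) (a : 'rV[R]_n) (p : M) : tangent p :=
  mk_tangent p (fun f => 'D_a (fun y => f (c y)) (coords c p)).

Definition pdiff (R : realType) (n m : nat) (M : charted R n)
    (M' : charted R m) (f : M -> M') (p : M) (v : tangent p) : tangent (f p) :=
  mk_tangent (f p) (fun g => v (fun q => g (f q))).

Definition tangent_bundle (R : realType) (n : nat) (M : charted R n)
    : charted R (n + n) :=
  Charted {p : M & tangent p}
    [set e | exists c, atlas M c /\
       e = Param [set z | pdom c (lsubmx z)]
                 (fun z => existT _ (c (lsubmx z))
                             (coord_vec c (rsubmx z) (c (lsubmx z))))].

Notation "'TM' M" := (tangent_bundle M) (at level 8, M at level 2).

Definition tvec (R : realType) (n : nat) (M : charted R n) (p : M)
    (v : tangent p) : TM M := existT _ p v.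

Definition base (R : realType) (n : nat) (M : charted R n) (u : TM M) : M :=
  projT1 u.

Definition fiber (R : realType) (n : nat) (M : charted R n) (u : TM M)
    : tangent (base u) := projT2 u.

(** The derivative [f_* : TM -> TM']. *)
Definition tmap (R : realType) (n m : nat) (M : charted R n)
    (M' : charted R m) (f : M -> M') (u : TM M) : TM M' :=
  tvec (pdiff f (fiber u)).

(** * Vector fields, metrics and connections

    All the axioms are imposed on germs: a vector field is a section of the
    tangent bundle, and the conditions at [p] concern the sections that are
    smooth near [p]. *)

Definition vfield (R : realType) (n : nat) (M : charted R n) :=
  forall p : M, tangent p.

Definition smooth_field_at (R : realType) (n : nat) (M : charted R n)
    (X : vfield M) (p : M) : Prop :=
  smooth_map_at (fun q => tvec (X q)) p.

Definition bracket (R : realType) (n : nat) (M : charted R n)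
    (X Y : vfield M) : vfield M :=
  fun p => mk_tangent p
    (fun f => X p (fun q => Y q f) - Y p (fun q => X q f)).

Definition metric (R : realType) (n : nat) (M : charted R n) :=
  forall p : M, tangent p -> tangent p -> R.

Record riemannian (R : realType) (n : nat) (M : charted R n) (h : metric M)
    : Prop := {
  metric_linear : forall p (a : R) (u v w : tangent p),
    h p (a *: u + v) w = a * h p u w + h p v w ;
  metric_sym : forall p (u v : tangent p), h p u v = h p v u ;
  metric_pos : forall p (u : tangent p), u != 0 -> 0 < h p u u ;
  metric_smooth : forall p (X Y : vfield M),
    smooth_field_at X p -> smooth_field_at Y p ->
    smooth_fun_at (fun q => h q (X q) (Y q)) p
}.

(** [D p v Y] is the covariant derivative of [Y] in the direction [v]. *)
Definition connection (R : realType) (n : nat) (M : charted R n) :=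
  forall p : M, tangent p -> vfield M -> tangent p.

Record linear_connection (R : realType) (n : nat) (M : charted R n)
    (D : connection M) : Prop := {
  conn_linear : forall p (a : R) (v w : tangent p) Y, smooth_field_at Y p ->
    D p (a *: v + w) Y = a *: D p v Y + D p w Y ;
  conn_additive : forall p (v : tangent p) Y Z,
    smooth_field_at Y p -> smooth_field_at Z p ->
    D p v (fun q => Y q + Z q) = D p v Y + D p v Z ;
  conn_leibniz : forall p (v : tangent p) (f : M -> R) Y,
    smooth_fun_at f p -> smooth_field_at Y p ->
    D p v (fun q => f q *: Y q) = (v f : R) *: Y p + f p *: D p v Y ;
  conn_smooth : forall p X Y, smooth_field_at X p -> smooth_field_at Y p ->
    smooth_field_at (fun q => D q (X q) Y) p
}.

Definition torsion_free (R : realType) (n : nat) (M : charted R n)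
    (D : connection M) : Prop :=
  forall p X Y, smooth_field_at X p -> smooth_field_at Y p ->
    D p (X p) Y - D p (Y p) X - bracket X Y p = 0.

Definition curvature_free (R : realType) (n : nat) (M : charted R n)
    (D : connection M) : Prop :=
  forall p X Y Z,
    smooth_field_at X p -> smooth_field_at Y p -> smooth_field_at Z p ->
    D p (X p) (fun q => D q (Y q) Z) - D p (Y p) (fun q => D q (X q) Z)
      - D p (bracket X Y p) Z = 0.

Definition flat (R : realType) (n : nat) (M : charted R n)
    (D : connection M) : Prop :=
  torsion_free D /\ curvature_free D.

Definition dual_connections (R : realType) (n : nat) (M : charted R n)
    (h : metric M) (D D' : connection M) : Prop :=
  forall p X Y Z,
    smooth_field_at X p -> smooth_field_at Y p -> smooth_field_at Z p ->
    (X p (fun q => h q (Y q) (Z q)) : R) =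
      h p (D p (X p) Y) (Z p) + h p (Y p) (D' p (X p) Z).

(** The dual connection is determined by [dual_connections h D]. *)
Record dually_flat (R : realType) (n : nat) (M : charted R n) (h : metric M)
    (D : connection M) : Prop := {
  df_manifold : is_manifold M ;
  df_riemannian : riemannian h ;
  df_connection : linear_connection D ;
  df_flat : flat D ;
  df_dual : exists D' : connection M,
    [/\ linear_connection D', dual_connections h D D' & flat D']
}.

Definition affine_coords (R : realType) (n : nat) (M : charted R n)
    (D : connection M) (c : param R n M) : Prop :=
  coord_system c /\
  forall x, pdom c x -> forall i j : 'I_n,
    D (c x) (coord_vec c (evec R i) (c x)) (coord_vec c (evec R j)) = 0.

Definition affine_map (R : realType) (n m : nat) (M : charted R n)
    (D : connection M) (M' : charted R m) (D' : connection M')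
    (f : M -> M') : Prop :=
  smooth_map f /\
  forall p, exists (c : param R n M) (c' : param R m M')
      (A : 'M[R]_(n, m)) (B : 'rV[R]_m),
    [/\ affine_coords D c, affine_coords D' c', exists2 x, pdom c x & c x = p &
        forall y, pdom c y ->
          pdom c' (y *m A + B) /\ f (c y) = c' (y *m A + B)].

Definition isometric (R : realType) (n m : nat) (M : charted R n)
    (h : metric M) (M' : charted R m) (h' : metric M') (f : M -> M') : Prop :=
  forall p (u v : tangent p), h' (f p) (pdiff f u) (pdiff f v) = h p u v.

Definition immersion (R : realType) (n m : nat) (M : charted R n)
    (M' : charted R m) (f : M -> M') : Prop :=
  smooth_map f /\ forall p, injective (@pdiff R n m M M' f p).

(** * Kähler manifolds *)

Definition almost_complex (R : realType) (n : nat) (M : charted R n) :=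
  forall p : M, tangent p -> tangent p.

(** The coordinates [c] are the real and imaginary parts of holomorphic
    coordinates. *)
Definition holomorphic_coords (R : realType) (n : nat) (N : charted R (n + n))
    (J : almost_complex N) (c : param R (n + n) N) : Prop :=
  coord_system c /\
  forall x, pdom c x -> forall a b : 'rV[R]_n,
    J (c x) (coord_vec c (row_mx a b) (c x)) =
    coord_vec c (row_mx (- b) a) (c x).

Definition integrable_J (R : realType) (n : nat) (N : charted R (n + n))
    (J : almost_complex N) : Prop :=
  forall p, exists c x, [/\ holomorphic_coords J c, pdom c x & c x = p].

Definition kahler_form (R : realType) (n : nat) (N : charted R n)
    (g : metric N) (J : almost_complex N) (p : N) (u v : tangent p) : R :=
  g p (J p u) v.

(** The coefficient functions of [d omega] vanish in all coordinates. *)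
Definition closed_2form (R : realType) (n : nat) (N : charted R n)
    (omega : forall p : N, tangent p -> tangent p -> R) : Prop :=
  forall c, coord_system c -> forall x, pdom c x -> forall i j k : 'I_n,
    let w i j := fun y => omega (c y) (coord_vec c (evec R i) (c y))
                                      (coord_vec c (evec R j) (c y)) in
    'D_(evec R i) (w j k) x + 'D_(evec R j) (w k i) x
      + 'D_(evec R k) (w i j) x = 0.

Record kahler (R : realType) (n : nat) (N : charted R (n + n))
    (g : metric N) (J : almost_complex N) : Prop := {
  kahler_manifold : is_manifold N ;
  kahler_riemannian : riemannian g ;
  kahler_J_linear : forall p (a : R) (u v : tangent p),
    J p (a *: u + v) = a *: J p u + J p v ;
  kahler_J_smooth : forall p X, smooth_field_at X p ->
    smooth_field_at (fun q => J q (X q)) p ;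
  kahler_J_sqr : forall p (u : tangent p), J p (J p u) = - u ;
  kahler_J_integrable : integrable_J J ;
  kahler_hermitian : forall p (u v : tangent p),
    g p (J p u) (J p v) = g p u v ;
  kahler_closed : closed_2form (kahler_form g J)
}.

Definition holomorphic (R : realType) (n m : nat) (N : charted R n)
    (J : almost_complex N) (N' : charted R m) (J' : almost_complex N')
    (f : N -> N') : Prop :=
  smooth_map f /\
  forall p (u : tangent p), pdiff f (J p u) = J' (f p) (pdiff f u).

(** The metric is real analytic for the real analytic structure underlying the
    complex structure. *)
Definition analytic_metric (R : realType) (n : nat) (N : charted R (n + n))
    (g : metric N) (J : almost_complex N) : Prop :=
  forall c, holomorphic_coords J c -> forall i j : 'I_(n + n),
    analytic_on (pdom c)
      (fun x => g (c x) (coord_vec c (evec R i) (c x))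
                        (coord_vec c (evec R j) (c x))).

Definition levi_civita (R : realType) (n : nat) (N : charted R n)
    (g : metric N) (D : connection N) : Prop :=
  [/\ linear_connection D, torsion_free D & dual_connections g D D].

(** In coordinates, [\sum_k x_k'' d_k + \sum_ij x_i' x_j' D_(d_i) d_j = 0]. *)
Definition geodesic (R : realType) (n : nat) (N : charted R n)
    (D : connection N) (gam : R -> N) : Prop :=
  forall t : R, exists (c : param R n N) (x : R -> 'rV[R]_n),
    [/\ coord_system c,
        \forall s \near t, pdom c (x s) /\ gam s = c (x s),
        \forall s \near t, forall i, derivable (fun r => x r 0 i) s 1 /\
          derivable (derive1 (fun r => x r 0 i)) s 1 &
        let dx i := derive1 (fun r => x r 0 i) in
        let dv := fun i => coord_vec c (evec R i) in
        \sum_k derive1 (dx k) t *: dv k (c (x t)) +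
        \sum_i \sum_j (dx i t * dx j t) *: D (c (x t)) (dv i (c (x t))) (dv j)
          = 0].

Definition velocity (R : realType) (n : nat) (N : charted R n)
    (gam : R -> N) (t : R) : TM N :=
  tvec (mk_tangent (gam t) (fun f => derive1 (fun s => f (gam s)) t)).

(** Geodesic completeness. *)
Definition complete_metric (R : realType) (n : nat) (N : charted R n)
    (g : metric N) : Prop :=
  exists D, levi_civita g D /\
    forall u : TM N, exists gam : R -> N,
      [/\ geodesic D gam, gam 0 = base u & velocity gam 0 = u].

Definition simply_connected (R : realType) (T : topologicalType) : Prop :=
  connected [set: T] /\
  forall gam : R -> T, {within `[0, 1], continuous gam} -> gam 0 = gam 1 ->
  exists H : R * R -> T,
    [/\ {within `[0, 1] `*` `[0, 1], continuous H},
        forall s, s \in `[0, 1] -> H (0, s) = gam s /\ H (1, s) = gam 0 &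
        forall t, t \in `[0, 1] -> H (t, 0) = gam 0 /\ H (t, 1) = gam 0].

Record regular_kahler (R : realType) (n : nat) (N : charted R (n + n))
    (g : metric N) (J : almost_complex N) : Prop := {
  regular_connected : connected [set: N] ;
  regular_simply_connected : simply_connected R N ;
  regular_complete : complete_metric g ;
  regular_analytic : analytic_metric g J
}.

(** * Dombrowski's Kähler structure on TM *)

Definition is_connector (R : realType) (n : nat) (M : charted R n)
    (D : connection M) (K : forall u : TM M, tangent u -> tangent (base u))
    : Prop :=
  (forall u (a : R) (A B : tangent u), K u (a *: A + B) = a *: K u A + K u B) /\
  (forall p (v : tangent p) (Y : vfield M), smooth_field_at Y p ->
     K (tvec (Y p)) (pdiff (fun q => tvec (Y q)) v) = D p v Y).

(** The unique map satisfying [is_connector]. *)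
Definition connector (R : realType) (n : nat) (M : charted R n)
    (D : connection M) : forall u : TM M, tangent u -> tangent (base u) :=
  xget (fun u _ => 0) [set K | is_connector D K].

Definition dombrowski_metric (R : realType) (n : nat) (M : charted R n)
    (h : metric M) (D : connection M) : metric (TM M) :=
  fun u A B =>
    h (base u) (pdiff (@base R n M) A) (pdiff (@base R n M) B) +
    h (base u) (connector D A) (connector D B).

(** [J (v, w) = (- w, v)] in [T_u(TM) = T_pM (+) T_pM]. *)
Definition dombrowski_J (R : realType) (n : nat) (M : charted R n)
    (D : connection M) : almost_complex (TM M) :=
  fun u A => xget 0 [set B | pdiff (@base R n M) B = - connector D A /\
                             connector D B = pdiff (@base R n M) A].

(** * Quotients by a group of transformations *)

Definition orbit_set (T : Type) (G : set (T -> T)) (x : T) : set T :=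
  [set y | exists2 s, G s & y = s x].

Definition quot_type (T : Type) (G : set (T -> T)) : Type :=
  {C : set T | exists x, C = orbit_set G x}.

Definition quot_proj (T : Type) (G : set (T -> T)) (x : T) : quot_type G :=
  exist _ (orbit_set G x) (ex_intro _ x erefl).

Definition quot_repr (T : Type) (G : set (T -> T)) (c : quot_type G) : T :=
  projT1 (cid (proj2_sig c)).

(** The parametrizations are the [q \o c], restricted to open sets on which
    they are injective. *)
Definition quotient (R : realType) (n : nat) (M : charted R n)
    (G : set (M -> M)) : charted R n :=
  Charted (quot_type G)
    [set e | exists c, [/\ atlas M c, open (pdom e), pdom e `<=` pdom c,
        pinjective e & forall x, pmap e x = quot_proj G (c x)]].

Definition qproj (R : realType) (n : nat) (M : charted R n)
    (G : set (M -> M)) : M -> quotient G := @quot_proj M G.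

Definition qrepr (R : realType) (n : nat) (M : charted R n)
    (G : set (M -> M)) : quotient G -> M := @quot_repr M G.

(** The metric [g'] and complex structure [J'] with [q^* g' = g] and
    [J' q_* = q_* J]. *)
Definition quot_metric (R : realType) (n : nat) (M : charted R n)
    (G : set (M -> M)) (g : metric M) : metric (quotient G) :=
  fun c A B => xget 0 [set r | exists u (A' B' : tangent u),
    [/\ tmap (@qproj R n M G) (tvec A') = tvec A,
        tmap (@qproj R n M G) (tvec B') = tvec B & r = g u A' B']].

Definition quot_J (R : realType) (n : nat) (M : charted R n)
    (G : set (M -> M)) (J : almost_complex M) : almost_complex (quotient G) :=
  fun c A => xget 0 [set B | exists u (A' : tangent u),
    tmap (@qproj R n M G) (tvec A') = tvec A /\
    tmap (@qproj R n M G) (tvec (J u A')) = tvec B].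

(** * The torus R^n/Z^n *)

Definition int_translations (R : realType) (n : nat)
    : set (euclid R n -> euclid R n) :=
  [set s | exists k : 'rV[int]_n, s = fun x => x + map_mx intr k].

Definition torus (R : realType) (n : nat) : charted R n :=
  quotient (@int_translations R n).

Definition torus_proj (R : realType) (n : nat) (t : 'rV[R]_n) : torus R n :=
  @qproj R n (euclid R n) (@int_translations R n) t.

Definition torus_repr (R : realType) (n : nat) (a : torus R n) : 'rV[R]_n :=
  @qrepr R n (euclid R n) (@int_translations R n) a.

Definition torus_zero (R : realType) (n : nat) : torus R n := torus_proj 0.

Definition torus_add (R : realType) (n : nat) (a b : torus R n) : torus R n :=
  torus_proj (torus_repr a + torus_repr b).

Definition lie_hom (R : realType) (n d : nat) (rho : torus R n -> torus R d)
    : Prop :=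
  smooth_map rho /\
  forall a b, rho (torus_add a b) = torus_add (rho a) (rho b).

(** The identification of R^n with the tangent space of R^n/Z^n at 0. *)
Definition torus_lie (R : realType) (n : nat) (t : 'rV[R]_n)
    : TM (torus R n) :=
  tmap (@torus_proj R n : euclid R n -> torus R n)
    (tvec (@coord_vec R n (euclid R n) (Param setT id) t 0)).

Definition lie_deriv (R : realType) (n d : nat) (rho : torus R n -> torus R d)
    (t : 'rV[R]_n) : 'rV[R]_d :=
  xget 0 [set s | torus_lie s = tmap rho (torus_lie t)].

Record torus_action (R : realType) (n m : nat) (N : charted R m)
    (Phi : torus R n -> N -> N) : Prop := {
  action_zero : forall x, Phi (torus_zero R n) x = x ;
  action_add : forall a b x, Phi (torus_add a b) x = Phi a (Phi b x) ;
  action_smooth : @smooth_map R _ _ (prod_charted (torus R n) N) N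
                    (fun z => Phi z.1 z.2)
}.

Definition effective (R : realType) (n m : nat) (N : charted R m)
    (Phi : torus R n -> N -> N) : Prop :=
  forall a, (forall x, Phi a x = x) -> a = torus_zero R n.

Definition free_points (R : realType) (n m : nat) (N : charted R m)
    (Phi : torus R n -> N -> N) : set N :=
  [set x | forall a, Phi a x = x -> a = torus_zero R n].

(** * Parallel lattices and torifications *)

Definition parallel (R : realType) (n : nat) (M : charted R n)
    (D : connection M) (X : vfield M) : Prop :=
  forall p, smooth_field_at X p /\ forall v : tangent p, D p v X = 0.

(** [(T_X)_t] *)
Definition translation (R : realType) (n : nat) (M : charted R n)
    (X : 'I_n -> vfield M) (t : 'rV[R]_n) (u : TM M) : TM M :=
  tvec (fiber u + \sum_k t 0 k *: X k (base u)).

Definition generator (R : realType) (n : nat) (M : charted R n)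
    (D : connection M) (L : set (TM M)) (X : 'I_n -> vfield M) : Prop :=
  [/\ forall k, parallel D (X k),
      forall p (v : tangent p), exists! t : 'rV[R]_n,
        v = \sum_k t 0 k *: X k p &
      L = [set u | exists p (k : 'rV[int]_n),
             u = tvec (\sum_i (k 0 i)%:~R *: X i p)]].

Definition parallel_lattice (R : realType) (n : nat) (M : charted R n)
    (D : connection M) (L : set (TM M)) : Prop :=
  exists X, generator D L X.

Definition Gamma (R : realType) (n : nat) (M : charted R n)
    (D : connection M) (L : set (TM M)) : set (TM M -> TM M) :=
  [set s | exists X (k : 'rV[int]_n),
     generator D L X /\ s = translation X (map_mx intr k)].

(** The quotient [M_L], its Kähler structure, and the maps [q_L], [pi_L]. *)
Definition ML (R : realType) (n : nat) (M : charted R n)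
    (D : connection M) (L : set (TM M)) : charted R (n + n) :=
  quotient (Gamma D L).

Definition ML_metric (R : realType) (n : nat) (M : charted R n) (h : metric M)
    (D : connection M) (L : set (TM M)) : metric (ML D L) :=
  quot_metric (dombrowski_metric h D).

Definition ML_J (R : realType) (n : nat) (M : charted R n)
    (D : connection M) (L : set (TM M)) : almost_complex (ML D L) :=
  quot_J (dombrowski_J D).

Definition qL (R : realType) (n : nat) (M : charted R n)
    (D : connection M) (L : set (TM M)) : TM M -> ML D L :=
  @qproj R _ (TM M) (Gamma D L).

Definition piL (R : realType) (n : nat) (M : charted R n)
    (D : connection M) (L : set (TM M)) (c : ML D L) : M := base (qrepr c).

(** [Phi_X ([t], q_L u) = q_L ((T_X)_t u)] *)
Definition lattice_action (R : realType) (n : nat) (M : charted R n)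
    (D : connection M) (L : set (TM M)) (X : 'I_n -> vfield M)
    (a : torus R n) (c : ML D L) : ML D L :=
  qL D L (translation X (torus_repr a) (qrepr c)).

(** [F] is a diffeomorphism onto the open set [A]. *)
Definition diffeo_onto (R : realType) (m : nat) (P N : charted R m)
    (F : P -> N) (A : set N) : Prop :=
  [/\ open A, smooth_map F, range F = A &
      exists G : N -> P, cancel F G /\ forall x, A x -> smooth_map_at G x].

Record toric_parametrization (R : realType) (n : nat) (M : charted R n)
    (h : metric M) (D : connection M) (N : charted R (n + n)) (g : metric N)
    (J : almost_complex N) (Phi : torus R n -> N -> N)
    (L : set (TM M)) (X : 'I_n -> vfield M) (F : ML D L -> N) : Prop := {
  tp_generator : generator D L X ;
  tp_diffeo : diffeo_onto F (free_points Phi) ;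
  tp_holomorphic : holomorphic (@ML_J R n M D L) J F ;
  tp_isometric : isometric (@ML_metric R n M h D L) g F ;
  tp_equivariant : forall a c, F (lattice_action X a c) = Phi a (F c)
}.

Record torification (R : realType) (n : nat) (M : charted R n)
    (h : metric M) (D : connection M) (N : charted R (n + n)) (g : metric N)
    (J : almost_complex N) (Phi : torus R n -> N -> N) : Prop := {
  torif_kahler : kahler g J ;
  torif_connected : connected [set: N] ;
  torif_action : torus_action Phi ;
  torif_effective : effective Phi ;
  torif_holomorphic : forall a, holomorphic J J (Phi a) ;
  torif_isometric : forall a, isometric g g (Phi a) ;
  torif_param : exists L X (F : ML D L -> N),
    toric_parametrization h g J Phi X F
}.

Definition regular_torification (R : realType) (n : nat) (M : charted R n)
    (h : metric M) (D : connection M) (N : charted R (n + n)) (g : metric N)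
    (J : almost_complex N) (Phi : torus R n -> N -> N) : Prop :=
  torification h D g J Phi /\ regular_kahler g J.

(** [tau = F \o q_L] and [kappa = pi_L \o F^-1]. *)
Definition toric_factorization (R : realType) (n : nat) (M : charted R n)
    (D : connection M) (N : charted R (n + n)) (Phi : torus R n -> N -> N)
    (L : set (TM M)) (F : ML D L -> N)
    (tau : TM M -> N) (kappa : {x : N | free_points Phi x} -> M) : Prop :=
  (forall u, tau u = F (qL D L u)) /\
  (forall x c, F c = proj1_sig x -> kappa x = piL c).

(** [m] is the lift [m_{tau' tau}(f)] and [rho] the homomorphism
    [rho_{tau' tau}(f)]: for regular torifications and isometric affine
    immersions [f], they exist and are characterized by these properties. *)
Definition is_lift (R : realType) (n d : nat) (M : charted R n)
    (M' : charted R d) (N : charted R (n + n)) (N' : charted R (d + d))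
    (tau : TM M -> N) (tau' : TM M' -> N') (f : M -> M') (m : N -> N')
    : Prop :=
  smooth_map m /\ forall u, m (tau u) = tau' (tmap f u).

Definition is_lift_hom (R : realType) (n d : nat)
    (N : charted R (n + n)) (N' : charted R (d + d))
    (Phi : torus R n -> N -> N) (Phi' : torus R d -> N' -> N') (m : N -> N')
    (rho : torus R n -> torus R d) : Prop :=
  lie_hom rho /\ forall a x, m (Phi a x) = Phi' (rho a) (m x).

(* Main.v *)
Require Import Defs.
From mathcomp Require Import all_boot all_order all_algebra.
From mathcomp Require Import all_classical all_reals all_analysis.
From mathcomp Require Import zify lra.

Set Implicit Arguments.
Unset Strict Implicit.
Unset Printing Implicit Defensive.

Import Order.TTheory GRing.Theory Num.Theory.
Import numFieldNormedType.Exports.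

Local Open Scope classical_set_scope.
Local Open Scope ring_scope.

(** The idea is to compare the two maps on a single fibre [T_p M], where both
    are affine.  Expanding [f_* X_k(p)] in the basis [X'(f p)] gives a matrix
    [A] with [f_* (u + \sum_k t_k X_k) = f_* u + \sum_j (t A)_j X'_j]
    ([tmap_translation]), so that it remains to identify [t A] with the image of
    [t] under the derivative of [rho].

    The lift [m] carries the action of [[t]] to that of [rho [t]], and [tau],
    [tau'] turn translations of tangent vectors into the torus actions.  Hence
    [tau' (f_* (u + t X))] equals both [tau' (f_* u + (t A) X')] and
    [tau' (f_* u + s X')] for any [s] representing [rho [t]].  Now [F'] is
    injective and the fibres of [q_L'] are the orbits of integral translations
    by [X'] ([qLP]), so [t A - s] is integral: [rho [t] = [t A]] for every [t].
    A homomorphism of tori that lifts to the linear map [A] has derivative [A]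
    ([lie_derivE]): by the chain rule [t A] is a solution of the equation
    defining the derivative, and the solution is unique because the local
    coordinates of the torus separate its tangent vectors at 0
    ([torus_lie_inj]).

    Since tangent vectors are derivations of germs of smooth functions, the
    derivative of a map is computable, and linear, as soon as composition with
    that map preserves smooth germs ([pullback_smooth]).  For a smooth map this
    is the closure of smooth functions under composition
    ([smooth_near_comp]). *)

(** * Differentiability of functions on R^n *)

(** The differential is characterized by an expansion up to [o(h)], and the two
    expansions coincide near 0. *)
Lemma near_eq_differentiable (R : realType) (V W : normedModType R)
    (f g : V -> W) (x : V) :
  (\forall y \near x, f y = g y) -> differentiable f x -> differentiable g x.
Proof.
move=> fg df.
have [dfc fE] := (diff_locallyP x f).1 df.
have gE : g \o shift x = cst (g x) + 'd f x +o_ 0 id.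
  apply/eqaddoP => e e0.
  have /eqaddoP/(_ e e0) fe := fE.
  have fg0 : \forall h \near (0 : V), f (h + x) = g (h + x).
    by move: fg; rewrite (near_shift 0 x) subr0.
  apply: filterS2 fe fg0 => h.
  by rewrite !fctE /= (nbhs_singleton fg) => + <-.
apply/diff_locallyP; rewrite (diff_unique dfc gE); split => //.
Qed.

Lemma differentiable_row (R : realType) (V : normedModType R) (m : nat)
    (G : V -> 'rV[R]_m) (x : V) :
  (forall j, differentiable (fun y => G y 0 j) x) -> differentiable G x.
Proof.
move=> dG.
have -> : G = \sum_(j < m) (fun y => G y 0 j *: delta_mx 0 j).
  by apply/funext => y; rewrite fct_sumE {1}(row_sum_delta (G y)).
by apply: differentiable_sum => j; exact: differentiableZl.
Qed.

Lemma derive_comp_row (R : realType) (n m : nat) (G : 'rV[R]_n -> 'rV[R]_m)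
    (h : 'rV[R]_m -> R) (x v : 'rV[R]_n) :
  (forall j, differentiable (fun y => G y 0 j) x) -> differentiable h (G x) ->
  'D_v (fun y => h (G y)) x =
  \sum_j 'D_(evec R j) h (G x) * 'D_v (fun y => G y 0 j) x.
Proof.
move=> dGj dh; have dG := differentiable_row dGj.
rewrite (deriveE v (differentiable_comp dG dh)) diff_comp //=.
rewrite -(deriveE v dG) (derive_mx (diff_derivable dG)).
rewrite [X in 'd h _ X]row_sum_delta linear_sum; apply: eq_bigr => j _.
by rewrite linearZ !mxE -deriveE // mulrC.
Qed.

(** The two difference quotients are the same function, so the rule also holds
    where the derivatives are default values. *)
Lemma derive_mulmx (R : realType) (n m : nat) (A : 'M[R]_(n, m))
    (h : 'rV[R]_m -> R) (x v : 'rV[R]_n) :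
  'D_v (fun y => h (y *m A)) x = 'D_(v *m A) h (x *m A).
Proof.
rewrite /derive.
have -> // : (fun r : R => r^-1 *:
    (((fun y => h (y *m A)) \o shift x) (r *: v) - h (x *m A))) =
  (fun r : R => r^-1 *: ((h \o shift (x *m A)) (r *: (v *m A)) - h (x *m A))).
by apply/funext => r /=; rewrite mulmxDl scalemxAl.
Qed.

(** * Smooth functions *)

Section Ck.
Context (R : realType) (n : nat).
Implicit Types (V W : set 'rV[R]_n) (f g : 'rV[R]_n -> R).

(** Openness of [V] is what makes the partial derivatives on [V] depend only on
    the values there. *)
Lemma Ck_eq k V f g : open V -> (forall x, V x -> f x = g x) ->
  Ck k V f -> Ck k V g.
Proof.
move=> oV; elim: k f g => [|k IH] f g fg /=.
  move=> fc x Vx; have nV : nbhs x V by exact: open_nbhs_nbhs.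
  rewrite /prop_for /continuous_at -fg //; apply: cvg_trans (fc x Vx).
  apply: (@near_eq_cvg _ _ (nbhs x)).
  by apply: filterS nV => y Vy; rewrite fg.
have nfg x : V x -> \forall y \near x, f y = g y.
  move=> Vx; have nV : nbhs x V by exact: open_nbhs_nbhs.
  by apply: filterS nV => y; exact: fg.
move=> [df cf]; split => [x Vx|i].
  exact: near_eq_differentiable (nfg x Vx) (df x Vx).
apply: IH (cf i) => x Vx; exact: near_eq_derive (nfg x Vx).
Qed.

Lemma Ck_sub k V W f : V `<=` W -> Ck k W f -> Ck k V f.
Proof.
move=> VW; elim: k f => [|k IH] f /= => [fc x /VW|[df cf]]; first exact: fc.
by split => [x /VW|i]; [exact: df|exact: IH].
Qed.

Lemma CkS k V f : Ck k.+1 V f -> Ck k V f.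
Proof.
elim: k f => [|k IH] f /= [df cf].
  by move=> x Vx; exact/differentiable_continuous/df.
by split => // i; exact: IH.
Qed.

Lemma Ck_cst k V (a : R) : Ck k V (fun=> a).
Proof.
elim: k a => [|k IH] a /=; first by move=> x _; exact: cst_continuous.
split => [x _|i]; first exact: differentiable_cst.
by under eq_fun do rewrite derive_cst; exact: IH.
Qed.

Lemma derive_coord (x v : 'rV[R]_n) (j : 'I_n) :
  'D_v (fun y : 'rV[R]_n => y 0 j) x = v 0 j.
Proof.
have := @derive_mx R _ _ _ id x v (@derivable_id _ _ _ _).
by rewrite derive_id => /matrixP/(_ 0 j)->; rewrite mxE.
Qed.

Lemma Ck_coord k V (j : 'I_n) : Ck k V (fun x => x 0 j).
Proof.
case: k => [x _|k] /=; first exact: coord_continuous.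
split => [x _|i]; first exact: differentiable_coord.
under eq_fun do rewrite derive_coord; exact: Ck_cst.
Qed.

Lemma CkD k V f g : open V -> Ck k V f -> Ck k V g ->
  Ck k V (fun x => f x + g x).
Proof.
move=> oV; elim: k f g => [|k IH] f g /= => [fc gc x Vx|[df cf] [dg cg]].
  by apply: continuousD; [exact: fc|exact: gc].
split => [x Vx|i]; first by apply: differentiableD; [exact: df|exact: dg].
apply: Ck_eq (IH _ _ (cf i) (cg i)) => // x Vx.
by rewrite -deriveD //; apply: diff_derivable; [exact: df|exact: dg].
Qed.

Lemma CkM k V f g : open V -> Ck k V f -> Ck k V g ->
  Ck k V (fun x => f x * g x).
Proof.
move=> oV; elim: k f g => [|k IH] f g => [fc gc x Vx|cf cg].
  by apply: continuousM; [exact: fc|exact: gc].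
have [df dcf] := cf; have [dg dcg] := cg.
split => [x Vx|i]; first by apply: differentiableM; [exact: df|exact: dg].
apply: Ck_eq (CkD oV (IH _ _ (CkS cf) (dcg i)) (IH _ _ (CkS cg) (dcf i))) => //.
move=> x Vx; rewrite -[LHS]deriveM //; apply: diff_derivable.
  exact: df.
exact: dg.
Qed.

Lemma Ck_sum k V (I : finType) (F : I -> 'rV[R]_n -> R) : open V ->
  (forall i, Ck k V (F i)) -> Ck k V (fun x => \sum_i F i x).
Proof.
move=> oV cF; have -> : (fun x => \sum_i F i x) = \sum_i F i.
  by apply/funext => x; rewrite fct_sumE.
elim/big_ind : _ => // [|f g cf cg]; first exact: Ck_cst.
exact: CkD.
Qed.

End Ck.

(** By the chain rule the partial derivatives of [h \o G] are sums of products
    of [C^k] functions, the first factors being [C^k] by induction, applied to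
    the partial derivatives of [h]. *)
Lemma Ck_comp (R : realType) (n m k : nat) (V : set 'rV[R]_n)
    (W : set 'rV[R]_m) (G : 'rV[R]_n -> 'rV[R]_m) (h : 'rV[R]_m -> R) :
  open V -> (forall x, V x -> W (G x)) ->
  (forall k j, Ck k V (fun x => G x 0 j)) ->
  Ck k W h -> Ck k V (fun x => h (G x)).
Proof.
move=> oV VW cG.
have dG x : V x -> forall j, differentiable (fun y => G y 0 j) x.
  by move=> Vx j; have [+ _] := cG 1%N j; exact.
elim: k h => [|k IH] h => [hc x Vx|[dh ch]].
  apply: (@continuous_comp _ _ _ G h).
    exact/differentiable_continuous/differentiable_row/dG.
  exact/hc/VW.
split => [x Vx|i].
  apply: (differentiable_comp (differentiable_row (dG x Vx))).
  exact/dh/VW.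
apply: (@Ck_eq _ _ _ _ (fun x => \sum_j 'D_(evec R j) h (G x) *
    'D_(evec R i) (fun y => G y 0 j) x)) => //.
  by move=> x Vx; rewrite derive_comp_row //; [exact: dG|exact/dh/VW].
apply: Ck_sum => // j; apply: CkM => //; first exact: (IH _ (ch j)).
by have [_] := cG k.+1 j; exact.
Qed.

Lemma smooth_near_eq (R : realType) (n : nat) (x : 'rV[R]_n)
    (f g : 'rV[R]_n -> R) :
  (\forall y \near x, f y = g y) -> smooth_near x f -> smooth_near x g.
Proof.
move=> fg [V [oV Vx cf]].
have oU := openI oV (open_interior [set y | f y = g y]).
exists (V `&` interior [set y | f y = g y]); split => // k.
apply: Ck_eq (Ck_sub (@subIsetl _ _ _) (cf k)) => //.
by move=> y [_ /interior_subset].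
Qed.

Lemma smooth_near_cst (R : realType) (n : nat) (x : 'rV[R]_n) (a : R) :
  smooth_near x (fun=> a).
Proof. by exists setT; split => // [|k]; [exact: openT|exact: Ck_cst]. Qed.

Lemma smooth_near_coord (R : realType) (n : nat) (x : 'rV[R]_n) (j : 'I_n) :
  smooth_near x (fun y => y 0 j).
Proof. by exists setT; split => // [|k]; [exact: openT|exact: Ck_coord]. Qed.

Lemma smooth_nearD (R : realType) (n : nat) (x : 'rV[R]_n)
    (f g : 'rV[R]_n -> R) :
  smooth_near x f -> smooth_near x g -> smooth_near x (fun y => f y + g y).
Proof.
move=> [V [oV Vx cf]] [U [oU Ux cg]]; exists (V `&` U).
have oVU := openI oV oU; split=> // k; apply: CkD => //.
  exact: Ck_sub (@subIsetl _ _ _) (cf k).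
exact: Ck_sub (@subIsetr _ _ _) (cg k).
Qed.

Lemma smooth_nearM (R : realType) (n : nat) (x : 'rV[R]_n)
    (f g : 'rV[R]_n -> R) :
  smooth_near x f -> smooth_near x g -> smooth_near x (fun y => f y * g y).
Proof.
move=> [V [oV Vx cf]] [U [oU Ux cg]]; exists (V `&` U).
have oVU := openI oV oU; split=> // k; apply: CkM => //.
  exact: Ck_sub (@subIsetl _ _ _) (cf k).
exact: Ck_sub (@subIsetr _ _ _) (cg k).
Qed.

Lemma smooth_near_differentiable (R : realType) (n : nat) (x : 'rV[R]_n)
    (f : 'rV[R]_n -> R) : smooth_near x f -> differentiable f x.
Proof. by move=> [V [_ Vx /(_ 1%N)[+ _]]]; exact. Qed.

(** Smoothness near [x] provides one neighbourhood for each coordinate of [G];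
    there are finitely many. *)
Lemma vsmooth_near_nbhd (R : realType) (n m : nat) (x : 'rV[R]_n)
    (G : 'rV[R]_n -> 'rV[R]_m) : vsmooth_near x G ->
  exists V, [/\ open V, V x & forall k j, Ck k V (fun y => G y 0 j)].
Proof.
move=> /choice[V VP]; exists (interior [set y | forall j, V j y]); split.
- exact: open_interior.
- suff : \forall y \near x, forall j, V j y by [].
  apply: (@filter_forall _ _ V (nbhs x)) => j.
  by have [oV Vx _] := VP j; exact: open_nbhs_nbhs.
- move=> k j; have [_ _ cG] := VP j; apply: Ck_sub (cG k) => y.
  by move=> /interior_subset; exact.
Qed.

Lemma vsmooth_near_continuous (R : realType) (n m : nat) (x : 'rV[R]_n)
    (G : 'rV[R]_n -> 'rV[R]_m) : vsmooth_near x G -> {for x, continuous G}.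
Proof.
move=> sG; apply/differentiable_continuous/differentiable_row => j.
exact: smooth_near_differentiable.
Qed.

Lemma smooth_near_comp (R : realType) (n m : nat) (x : 'rV[R]_n)
    (G : 'rV[R]_n -> 'rV[R]_m) (h : 'rV[R]_m -> R) :
  vsmooth_near x G -> smooth_near (G x) h -> smooth_near x (fun y => h (G y)).
Proof.
move=> sG [W [oW WGx ch]]; have [V [oV Vx cG]] := vsmooth_near_nbhd sG.
have nW : nbhs x (G @^-1` W).
  exact/(vsmooth_near_continuous sG)/open_nbhs_nbhs.
have oU := openI oV (open_interior (G @^-1` W)).
exists (V `&` interior (G @^-1` W)).
split => [//|//|k].
apply: (@Ck_comp _ _ _ _ _ W) => [//|y [_ /interior_subset]//|l j|//].
exact: Ck_sub (@subIsetl _ _ _) (cG l j).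
Qed.

(** * Derivatives of maps between manifolds *)

Lemma smooth_funD (R : realType) (n : nat) (M : charted R n) (p : M)
    (a : R) (f g : M -> R) :
  smooth_fun_at f p -> smooth_fun_at g p ->
  smooth_fun_at (fun q => a * f q + g q) p.
Proof.
move=> sf sg c cM x cx cxp; apply: smooth_nearD; last exact: sg.
apply: smooth_nearM; [exact: smooth_near_cst|exact: sf].
Qed.

Lemma smooth_funM (R : realType) (n : nat) (M : charted R n) (p : M)
    (f g : M -> R) :
  smooth_fun_at f p -> smooth_fun_at g p ->
  smooth_fun_at (fun q => f q * g q) p.
Proof.
by move=> sf sg c cM x cx cxp; apply: smooth_nearM; [exact: sf|exact: sg].
Qed.

(** This is what the functional [v (g \o f)] needs in order to be a derivation
    in [g]. *)
Definition pullback_smooth (R : realType) (n m : nat) (M : charted R n)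
    (M' : charted R m) (f : M -> M') (p : M) : Prop :=
  forall g, smooth_fun_at g (f p) -> smooth_fun_at (fun q => g (f q)) p.

(** A chart around [f p] is needed: if no chart covered [f p], every map would
    be smooth at [p]. *)
Lemma smooth_map_pullback (R : realType) (n m : nat) (M : charted R n)
    (M' : charted R m) (f : M -> M') (p : M) :
  (exists c' x', [/\ atlas M' c', pdom c' x' & c' x' = f p]) ->
  smooth_map_at f p -> pullback_smooth f p.
Proof.
move=> [c' [x' [c'M c'x' c'f]]] sf g sg c cM x cx cxp.
have [G [sG fG]] := sf c cM x cx cxp c' c'M x' c'x' c'f.
have [c'Gx fGx] := nbhs_singleton fG.
apply: (@smooth_near_eq _ _ _ (fun y => g (c' (G y)))).
  by apply: filterS fG => y [_ ->].
apply: (smooth_near_comp (h := fun z => g (c' z)) sG); apply: sg c'M _ c'Gx _.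
by rewrite -fGx cxp.
Qed.

Lemma mk_tangentE (R : realType) (n : nat) (M : charted R n) (p : M)
    (D : (M -> R) -> R) :
  (forall (a : R) f g, smooth_fun_at f p -> smooth_fun_at g p ->
     D (fun q => a * f q + g q) = a * D f + D g) ->
  (forall f g, smooth_fun_at f p -> smooth_fun_at g p ->
     D (fun q => f q * g q) = D f * g p + f p * D g) ->
  forall f,
    dir (mk_tangent p D) f = if `[< smooth_fun_at f p >] then D f else 0.
Proof.
move=> DL DM f; rewrite /mk_tangent val_insubd ifT //.
apply/asboolP; split=> /= [{}f nf|a {}f g sf sg|{}f g sf sg].
- by rewrite asboolF.
- by rewrite !asboolT //; [exact: DL|exact: smooth_funD].
- by rewrite !asboolT //; [exact: DM|exact: smooth_funM].
Qed.

Lemma dir_inj (R : realType) (n : nat) (M : charted R n) (p : M)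
    (u v : tangent p) : (forall g, dir u g = dir v g) -> u = v.
Proof. by move=> uv; apply: val_inj; apply/funext. Qed.

Lemma dir_linear (R : realType) (n : nat) (M : charted R n) (p : M)
    (a : R) (u v : tangent p) g : dir (a *: u + v) g = a * dir u g + dir v g.
Proof. by []. Qed.

(** The functional of a tangent vector has a type that does not mention the base
    point, so comparing functionals avoids transport along [p = q]. *)
Lemma tvec_eqP (R : realType) (n : nat) (M : charted R n) (p q : M)
    (u : tangent p) (v : tangent q) :
  tvec u = tvec v <-> p = q /\ forall g, dir u g = dir v g.
Proof.
split=> [uv|[pq uv]].
  split; first by have := congr1 (@base R n M) uv.
  by move=> g; have := congr1 (fun w : TM M => dir (fiber w) g) uv.
by case: _ / pq v uv => v /dir_inj ->.
Qed.

Section Pdiff.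
Context (R : realType) (n m : nat) (M : charted R n) (M' : charted R m).
Context (f : M -> M') (p : M) (sf : pullback_smooth f p).

Lemma pdiffE (v : tangent p) g :
  dir (pdiff f v) g =
  if `[< smooth_fun_at g (f p) >] then dir v (fun q => g (f q)) else 0.
Proof.
have /asboolP[_ vL vM] := dirP v.
rewrite mk_tangentE // => [a g1 g2 sg1 sg2|g1 g2 sg1 sg2].
  by rewrite vL //; exact: sf.
by rewrite vM //; exact: sf.
Qed.

Lemma pdiff_linear (a : R) (u v : tangent p) :
  pdiff f (a *: u + v) = a *: pdiff f u + pdiff f v.
Proof.
apply: dir_inj => g; rewrite dir_linear !pdiffE; case: asboolP => _.
  by rewrite dir_linear.
by rewrite mulr0 addr0.
Qed.

Lemma pdiff_sum (I : Type) (r : seq I) (a : I -> R) (v : I -> tangent p) :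
  pdiff f (\sum_(i <- r) a i *: v i) = \sum_(i <- r) a i *: pdiff f (v i).
Proof.
elim: r => [|i r IH]; last by rewrite !big_cons pdiff_linear IH.
rewrite !big_nil; apply: (addrI (pdiff f (0 : tangent p))).
by rewrite -{1}[pdiff f 0]scale1r -pdiff_linear scale1r !addr0.
Qed.

End Pdiff.

Lemma smooth_fun_euclid (R : realType) (n : nat) (f : euclid R n -> R) x :
  smooth_fun_at (M := euclid R n) f x <-> smooth_near x f.
Proof.
split=> [sf|sf c -> y _ /= yx]; first exact: (sf _ erefl x).
by rewrite yx.
Qed.

Definition euclid_vec (R : realType) (n : nat) (a : 'rV[R]_n) :
    tangent (0 : euclid R n) :=
  coord_vec (M := euclid R n) (Param setT id) a 0.

Lemma euclid_vecE (R : realType) (n : nat) (a : 'rV[R]_n) f :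
  dir (euclid_vec a) f =
  if `[< smooth_near (0 : 'rV[R]_n) f >] then 'D_a f 0 else 0.
Proof.
have c0 : coords (T := euclid R n) (Param setT id) (0 : 'rV[R]_n) = 0.
  by rewrite /coords; case: xgetP => [y -> []|/(_ 0)/=[]].
rewrite mk_tangentE c0 => [|b g1 g2|g1 g2].
- by rewrite (propext (smooth_fun_euclid f 0)).
- move=> /smooth_fun_euclid/smooth_near_differentiable d1.
  move=> /smooth_fun_euclid/smooth_near_differentiable d2.
  rewrite [LHS](_ : _ = 'D_a (b *: g1 + g2) 0) // deriveD.
  + by rewrite deriveZ //; exact: diff_derivable.
  + by apply: derivableZ; exact: diff_derivable.
  + exact: diff_derivable.
- move=> /smooth_fun_euclid/smooth_near_differentiable d1.
  move=> /smooth_fun_euclid/smooth_near_differentiable d2.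
  rewrite [LHS](_ : _ = 'D_a (g1 * g2) 0) // deriveM; try exact: diff_derivable.
  by rewrite addrC /= mulrC.
Qed.

(** * Quotients *)

Lemma quot_proj_repr (T : Type) (G : set (T -> T)) (c : Defs.quot_type G) :
  quot_proj G (quot_repr c) = c.
Proof.
case: c => C cP; rewrite /quot_proj /quot_repr; case: cid => x /= cx.
by apply: eq_exist; rewrite cx.
Qed.

(** Stated for the orbit relation [E] of [G], and not for a group [G], because
    composing translations along two different generators of a lattice does not
    visibly give a translation along a generator. *)
Lemma quot_projP (T : Type) (G : set (T -> T)) (E : T -> T -> Prop) :
  (forall x y, orbit_set G x y <-> E x y) ->
  (forall x, E x x) -> (forall x y, E x y -> E y x) ->
  (forall x y z, E x y -> E y z -> E x z) ->
  forall x y, quot_proj G x = quot_proj G y <-> E x y.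
Proof.
move=> GE Er Es Et x y; split=> [xy|Exy].
  have : orbit_set G y y by apply/GE.
  by rewrite -[orbit_set G y](congr1 sval xy) => /GE.
apply: eq_exist; apply/seteqP; split=> z /GE Ez; apply/GE.
  exact: Et (Es _ _ Exy) Ez.
exact: Et Exy Ez.
Qed.

(** * The torus and the derivatives of its homomorphisms *)

Section Torus.
Context (R : realType) (n : nat).
Implicit Types (x y s t : 'rV[R]_n).

Lemma torus_projP x y :
  torus_proj x = torus_proj y <->
  exists k : 'rV[int]_n, y = x + map_mx intr k.
Proof.
apply: (@quot_projP _ (@int_translations R n)
  (fun x y => exists k : 'rV[int]_n, y = x + map_mx intr k)).
- move=> u v; split=> [[_ [k ->] ->]|[k ->]]; first by exists k.
  by exists (fun z => z + map_mx intr k) => //; exists k.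
- by move=> u; exists 0; rewrite map_mx0 addr0.
- by move=> u _ [k ->]; exists (- k); rewrite map_mxN addrK.
- move=> u _ _ [k ->] [l ->]; exists (k + l).
  by rewrite map_mxD addrA.
Qed.

Lemma torus_proj_repr (a : torus R n) : torus_proj (torus_repr a) = a.
Proof. exact: quot_proj_repr. Qed.

(** Points of a ball of radius 1/2 for the sup norm have coordinates that differ
    by less than 1, hence are equal if they are congruent modulo Z^n. *)
Lemma torus_proj_ball x y z : ball x (1 / 2) y -> ball x (1 / 2) z ->
  torus_proj y = torus_proj z -> y = z.
Proof.
move=> [_ xy] [_ xz] /torus_projP[k zE].
suff k0 : k = 0 by rewrite zE k0 map_mx0 addr0.
apply/rowP => j; rewrite mxE.
suff /andP[] : (-1 < k 0 j) && (k 0 j < 1) by lia.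
rewrite -!(ltr_int R) mulrNz !mulr1z.
have := xy 0 j; have := xz 0 j; rewrite zE !mxE /ball /=.
rewrite !ltr_norml => /andP[? ?] /andP[? ?].
by apply/andP; split; lra.
Qed.

Definition torus_chart x : param R n (torus R n) :=
  Param (ball x (1 / 2)) (@torus_proj R n).

Lemma torus_chart_atlas x : atlas (torus R n) (torus_chart x).
Proof.
exists (Param setT id); split => //=; first exact: ball_open.
by move=> y z; exact: torus_proj_ball.
Qed.

Lemma torus_chart_center x : pdom (torus_chart x) x.
Proof. exact: ballxx. Qed.

(** Every chart of the torus is a restriction of the projection. *)
Lemma torus_fun_smooth (g : torus R n -> R) (a : torus R n) :
  smooth_fun_at g a <->
  forall x, torus_proj x = a -> smooth_near x (fun y => g (torus_proj y)).
Proof.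
split=> [sg x xa|sg c [c0 [-> oc _ _ cE]] x cx cxa].
  exact: (sg _ (torus_chart_atlas x) x (torus_chart_center x)).
rewrite [X in smooth_near x X](_ : _ = fun y => g (torus_proj y)).
  by apply: sg; rewrite -cxa cE.
by apply/funext => y; rewrite cE.
Qed.

Lemma torus_lieE t g :
  dir (fiber (torus_lie t)) g =
  if `[< smooth_fun_at g (torus_zero R n) >]
  then 'D_t (fun x => g (torus_proj x)) 0 else 0.
Proof.
have sp : pullback_smooth (M := euclid R n) (@torus_proj R n) 0.
  by move=> h /torus_fun_smooth sh; apply/smooth_fun_euclid/sh.
rewrite [LHS](pdiffE sp (euclid_vec t)) euclid_vecE.
case: asboolP => // sg; rewrite asboolT //.
exact/smooth_fun_euclid/sp.
Qed.

(** A default value is taken at the points without a representative in the open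
    cube of side 1 around 0; only the germ at 0 matters. *)
Definition torus_coord (j : 'I_n) (a : torus R n) : R :=
  (xget 0 [set y | ball (0 : 'rV[R]_n) (1 / 2) y /\ torus_proj y = a]) 0 j.

Lemma torus_coordE j x : ball 0 (1 / 2) x ->
  torus_coord j (torus_proj x) = x 0 j.
Proof.
move=> bx; rewrite /torus_coord.
case: xgetP => [y _ [by_ yx]|/(_ x)[]//].
by rewrite (torus_proj_ball by_ bx yx).
Qed.

(** Near an integral point [x] the representative in the cube is [y - x], so the
    function is affine there. *)
Lemma torus_coord_smooth j : smooth_fun_at (torus_coord j) (torus_zero R n).
Proof.
apply/torus_fun_smooth => x xz.
apply: (@smooth_near_eq _ _ _ (fun y => y 0 j + (- x 0 j))); last first.
  by apply: smooth_nearD; [exact: smooth_near_coord|exact: smooth_near_cst].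
have xb : nbhs x (ball x (1 / 2)) by exact: nbhsx_ballx.
apply: filterS xb => y [_ xy].
have -> : torus_proj y = torus_proj (y - x).
  move/esym/torus_projP : xz => [k xE].
  by apply/torus_projP; exists (- k); rewrite xE add0r map_mxN.
rewrite torus_coordE ?mxE //; split=> [//|i l].
by have := xy i l; rewrite /ball /= !mxE sub0r opprB.
Qed.

(** Applying [torus_lie v] to the coordinate functions at 0 recovers [v]. *)
Lemma torus_lie_inj s t : torus_lie s = torus_lie t -> s = t.
Proof.
have D v j : dir (fiber (torus_lie v)) (torus_coord j) = v 0 j.
  rewrite torus_lieE asboolT; last exact: torus_coord_smooth.
  have near0 : \forall x \near (0 : 'rV[R]_n),
      torus_coord j (torus_proj x) = x 0 j.
    have b0 : nbhs (0 : 'rV[R]_n) (ball (0 : 'rV[R]_n) (1 / 2)).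
      exact: nbhsx_ballx.
    by apply: filterS b0 => x; exact: torus_coordE.
  by rewrite (near_eq_derive v near0) derive_coord.
move=> st; apply/rowP => j; rewrite -!D.
by have := congr1 (fun u : TM (torus R n) => dir (fiber u) (torus_coord j)) st.
Qed.

End Torus.

(** As [rho] lifts to the linear map [A], both sides send a function [g] to the
    derivative at 0, in the direction [t], of [x |-> g [x A]]. *)
Lemma tmap_torus_lie (R : realType) (n d : nat) (rho : torus R n -> torus R d)
    (A : 'M[R]_(n, d)) :
  smooth_map rho -> (forall t, rho (torus_proj t) = torus_proj (t *m A)) ->
  forall t, tmap rho (torus_lie t) = torus_lie (t *m A).
Proof.
move=> srho rhoE t.
have sp : pullback_smooth rho (torus_zero R n).
  apply: smooth_map_pullback (srho _).
  exists (torus_chart (0 *m A)), (0 *m A).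
  split; [exact: torus_chart_atlas|exact: torus_chart_center|].
  exact: esym (rhoE 0).
have rho0 : rho (torus_zero R n) = torus_zero R d by rewrite rhoE mul0mx.
apply/tvec_eqP; split => // g.
rewrite [LHS](pdiffE sp) [RHS]torus_lieE rho0; case: asboolP => // sg.
rewrite torus_lieE asboolT; last by have := sp g; rewrite rho0; exact.
have := derive_mulmx A (fun y => g (torus_proj y)) 0 t; rewrite mul0mx => <-.
by congr ('D_t _ 0); apply/funext => x; rewrite rhoE.
Qed.

Lemma lie_derivE (R : realType) (n d : nat) (rho : torus R n -> torus R d)
    (A : 'M[R]_(n, d)) :
  smooth_map rho -> (forall t, rho (torus_proj t) = torus_proj (t *m A)) ->
  forall t, lie_deriv rho t = t *m A.
Proof.
move=> srho rhoE t; rewrite /lie_deriv (tmap_torus_lie srho rhoE).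
by case: xgetP => [s _ /torus_lie_inj|/(_ (t *m A))[]].
Qed.

(** * Translations along a parallel lattice *)

Section Lattice.
Context (R : realType) (n : nat) (M : charted R n) (D : connection M).
Context (L : set (TM M)) (X : 'I_n -> vfield M) (gX : generator D L X).

Lemma translationD s t (u : TM M) :
  translation X s (translation X t u) = translation X (t + s) u.
Proof.
rewrite /translation /= -addrA -big_split /=; congr tvec; congr (_ + _).
by apply: eq_bigr => k _; rewrite -scalerDl !mxE.
Qed.

Lemma translation0 (u : TM M) : translation X 0 u = u.
Proof.
case: u => p v; rewrite /translation big1 /= ?addr0 // => k _.
by rewrite mxE scale0r.
Qed.

Lemma translation_inj s t (u : TM M) :
  translation X s u = translation X t u -> s = t.
Proof.
move=> /tvec_eqP[_ /dir_inj /addrI st].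
have [_ /(_ (base u) (\sum_k s 0 k *: X k (base u)))[r [_ ru]] _] := gX.
by rewrite -(ru s) // -(ru t).
Qed.

(** In the fibre over [p], the translation by any generator [Y] of [L] adds an
    element of [L] over [p], which is also an integral combination of the
    [X_i(p)].  The integral matrix relating [Y] to [X] may depend on [p] here. *)
Lemma orbit_GammaP (u v : TM M) :
  orbit_set (Gamma D L) u v <->
  exists k : 'rV[int]_n, v = translation X (map_mx intr k) u.
Proof.
split=> [[_ [Y [k [gY ->]]] ->]|[k ->]]; last first.
  by exists (translation X (map_mx intr k)) => //; exists X, k.
have [_ _ LX] := gX; have [_ _ LY] := gY.
have : L (tvec (\sum_i (k 0 i)%:~R *: Y i (base u))).
  by rewrite LY; exists (base u), k.
rewrite LX => -[p [l /tvec_eqP[pu lE]]].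
exists l; rewrite /translation; congr tvec; congr (_ + _).
case: _ / pu lE => /dir_inj lE.
transitivity (\sum_i (k 0 i)%:~R *: Y i (base u)).
  by apply: eq_bigr => i _; rewrite mxE.
by rewrite lE; apply: eq_bigr => i _; rewrite mxE.
Qed.

Lemma qLP (u v : TM M) :
  qL D L u = qL D L v <->
  exists k : 'rV[int]_n, v = translation X (map_mx intr k) u.
Proof.
apply: (@quot_projP _ (Gamma D L) (fun u v : TM M =>
  exists k : 'rV[int]_n, v = translation X (map_mx intr k) u)).
- exact: orbit_GammaP.
- by move=> w; exists 0; rewrite map_mx0 translation0.
- move=> w _ [k ->]; exists (- k).
  by rewrite translationD map_mxN subrr translation0.
- by move=> w _ _ [k ->] [l ->]; exists (k + l); rewrite translationD map_mxD.
Qed.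

(** The action is defined through chosen representatives of [a] and of the class
    of [u]; changing them moves the result by integral translations only. *)
Lemma lattice_actionE a t (u : TM M) : torus_proj t = a ->
  lattice_action X a (qL D L u) = qL D L (translation X t u).
Proof.
move=> <-; apply/qLP.
have /torus_projP[k tE] := torus_proj_repr (torus_proj t).
have /qLP[l uE] : qL D L (qrepr (qL D L u)) = qL D L u by exact: quot_proj_repr.
exists (l + k); rewrite {1}tE {1}uE !translationD map_mxD.
by rewrite addrCA.
Qed.

End Lattice.

Lemma generator_coords (R : realType) (n d : nat) (M : charted R n)
    (D : connection M) (L : set (TM M)) (X : 'I_n -> vfield M) (p : M)
    (v : 'I_d -> tangent p) : generator D L X ->
  exists A : 'M[R]_(d, n), forall k, v k = \sum_j A k j *: X j p.
Proof.
move=> [_ Xbasis _].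
have /choice[a aE] k : exists a : 'rV[R]_n, v k = \sum_j a 0 j *: X j p.
  by have [a [aE _]] := Xbasis p (v k); exists a.
exists (\matrix_k a k) => k; rewrite {1}aE.
by apply: eq_bigr => j _; rewrite mxE.
Qed.

Lemma tmap_translation (R : realType) (n d : nat) (M : charted R n)
    (M' : charted R d) (X : 'I_n -> vfield M) (X' : 'I_d -> vfield M')
    (f : M -> M') (u : TM M) (A : 'M[R]_(n, d)) :
  pullback_smooth f (base u) ->
  (forall k, pdiff f (X k (base u)) = \sum_j A k j *: X' j (f (base u))) ->
  forall t, tmap f (translation X t u) = translation X' (t *m A) (tmap f u).
Proof.
move=> sf AE t.
have fX : pdiff f (\sum_k t 0 k *: X k (base u)) =
          \sum_j (t *m A) 0 j *: X' j (f (base u)).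
  rewrite pdiff_sum //.
  under eq_bigr => k _ do rewrite AE scaler_sumr.
  rewrite exchange_big; apply: eq_bigr => j _.
  by rewrite mxE scaler_suml; apply: eq_bigr => k _; rewrite scalerA.
have E : pdiff f (fiber u + \sum_k t 0 k *: X k (base u)) =
         pdiff f (fiber u) + \sum_j (t *m A) 0 j *: X' j (f (base u)).
  by rewrite -{1}[fiber u]scale1r pdiff_linear // scale1r fX.
by have := congr1 (@tvec R d M' (f (base u))) E.
Qed.

Theorem proposition9p17 (R : realType) (n d : nat)
    (M : charted R n) (h : metric M) (D : connection M)
    (M' : charted R d) (h' : metric M') (D' : connection M')
    (N : charted R (n + n)) (g : metric N) (J : almost_complex N)
    (N' : charted R (d + d)) (g' : metric N') (J' : almost_complex N')
    (Phi : torus R n -> N -> N) (Phi' : torus R d -> N' -> N')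
    (L : set (TM M)) (X : 'I_n -> vfield M) (F : ML D L -> N)
    (L' : set (TM M')) (X' : 'I_d -> vfield M') (F' : ML D' L' -> N')
    (tau : TM M -> N) (kappa : {x : N | free_points Phi x} -> M)
    (tau' : TM M' -> N') (kappa' : {x : N' | free_points Phi' x} -> M')
    (f : M -> M') (m : N -> N') (rho : torus R n -> torus R d) :
  dually_flat h D -> connected [set: M] ->
  dually_flat h' D' -> connected [set: M'] ->
  regular_torification h D g J Phi ->
  regular_torification h' D' g' J' Phi' ->
  toric_parametrization h g J Phi X F ->
  toric_parametrization h' g' J' Phi' X' F' ->
  toric_factorization F tau kappa ->
  toric_factorization F' tau' kappa' ->
  isometric h h' f -> affine_map D D' f -> immersion f ->
  is_lift tau tau' f m ->
  is_lift_hom Phi Phi' m rho ->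
  forall t : 'rV[R]_n,
    tmap f \o translation X t =
    translation X' (lie_deriv rho t) \o tmap f.
Proof.
move=> _ _ df' _ _ _ tp tp' [tauE _] [tauE' _] _ [sf _] _.
move=> [_ mE] [[srho _] mPhi] t; apply/funext => u; rewrite /comp.
have spf : pullback_smooth f (base u).
  apply: smooth_map_pullback (sf _).
  exact: (manifold_cover (df_manifold df') (f (base u))).
have [A AE] := generator_coords (fun k => pdiff f (X k (base u)))
  (tp_generator tp').
have fT := tmap_translation spf AE.
have F'inj : injective F'.
  by have [_ _ _ [G [GK _]]] := tp_diffeo tp'; exact: can_inj GK.
have rhoE s : rho (torus_proj s) = torus_proj (s *m A).
  have : qL D' L' (tmap f (translation X s u)) =
         lattice_action X' (rho (torus_proj s)) (qL D' L' (tmap f u)).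
    apply: F'inj; rewrite (tp_equivariant tp') -!tauE' -!mE -mPhi !tauE.
    by rewrite -(tp_equivariant tp) (lattice_actionE (tp_generator tp) _ erefl).
  rewrite (lattice_actionE (tp_generator tp') _ (torus_proj_repr _)) fT.
  move=> /(qLP (tp_generator tp'))[k].
  rewrite translationD => /(translation_inj (tp_generator tp')) kE.
  by rewrite -(torus_proj_repr (rho _)) kE; apply/esym/torus_projP; exists k.
by rewrite fT (lie_derivE srho rhoE).
Qed.
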